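(* Let $A,B,C,D$ be real constant symmetric $2\times 2$ matrices satisfying the ellipticity (Legendre--Hadamard) condition $$\eta_1^2\,A\xi\cdot\xi+\eta_1\eta_2\,(B+C)\xi\cdot\xi+\eta_2^2\,D\xi\cdot\xi>0\quad\text{for every }\xi,\eta\in\mathbb R^2\setminus\{0\}.$$ Then the following alternative holds. Either (i) the system $$\left\{\begin{array}{l}\mathrm{div}(A\nabla u^1+B\nabla u^2)=0,\\ \mathrm{div}(C\nabla u^1+D\nabla u^2)=0\end{array}\right.$$ is equivalent to the system $$\left\{\begin{array}{l}\mathrm{div}(A\nabla u^1)=0,\\ \mathrm{div}(A\nabla u^2)=0,\end{array}\right.$$ or (ii) there exist a disk $\mathcal B\subset\mathbb R^2$, with center denoted by $O$, and a polynomial solution $u=(u^1,u^2)$ to $$\left\{\begin{array}{ll}\mathrm{div}(A\nabla u^1+B\nabla u^2)=0 & \text{in }\mathcal B,\\ \mathrm{div}(C\nabla u^1+D\nabla u^2)=0 & \text{in }\mathcal B,\end{array}\right.$$ which is a homeomorphism of the closed disk $\overline{\mathcal B}$ onto $u(\overline{\mathcal B})$ and such that $$\det Du(O)=0.$$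
   Context: The unknowns $u^1,u^2$ are real-valued functions of two real variables, $\nabla u^i$ is the gradient, regarded as a column vector, and $Du$ is the $2\times2$ Jacobian matrix of $u=(u^1,u^2)$. A polynomial solution is one whose components are both real polynomials in the two variables. The disk $\mathcal B$ is open. Equivalence of systems: the system $\mathrm{div}(A\nabla u^1+B\nabla u^2)=0$, $\mathrm{div}(C\nabla u^1+D\nabla u^2)=0$ is said to be equivalent to the system $\mathrm{div}(A'\nabla u^1+B'\nabla u^2)=0$, $\mathrm{div}(C'\nabla u^1+D'\nabla u^2)=0$ if there exists a non-singular real $2\times2$ matrix $\begin{pmatrix}\alpha&\beta\\ \gamma&\delta\end{pmatrix}$ such that, as $4\times 4$ block matrices, $$\begin{pmatrix}A&B\\ C&D\end{pmatrix}=\begin{pmatrix}\alpha\,\mathrm{Id}&\beta\,\mathrm{Id}\\ \gamma\,\mathrm{Id}&\delta\,\mathrm{Id}\end{pmatrix}\begin{pmatrix}A'&B'\\ C'&D'\end{pmatrix},$$ where $\mathrm{Id}$ is the $2\times2$ identity matrix. *)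

(* Defs.v *)
From HB Require Import structures.
From mathcomp Require Import all_boot all_order all_algebra.
From mathcomp Require Import all_classical all_reals all_analysis.

Set Implicit Arguments.
Unset Strict Implicit.
Unset Printing Implicit Defensive.

Import Order.TTheory GRing.Theory Num.Theory.
Import numFieldNormedType.Exports.

Local Open Scope classical_set_scope.
Local Open Scope ring_scope.

(* Points and vectors of the plane are column vectors.  The indices [0] and [1]
   of ['I_2] are the usual indices 1 and 2. *)

Definition dot (R : realType) (x y : 'cV[R]_2) : R := (x^T *m y) 0 0.

(* The library norm on ['cV[R]_2] is the max norm, whose balls are squares. *)
Definition enorm (R : realType) (x : 'cV[R]_2) : R := Num.sqrt (dot x x).

Definition disk (R : realType) (O : 'cV[R]_2) (r : R) : set 'cV[R]_2 :=
  [set x | enorm (x - O) < r].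

Definition partial (R : realType) (i : 'I_2) (f : 'cV[R]_2 -> R)
    (x : 'cV[R]_2) : R :=
  'D_(delta_mx i 0) f x.

Definition grad (R : realType) (f : 'cV[R]_2 -> R) (x : 'cV[R]_2) : 'cV[R]_2 :=
  \col_i partial i f x.

Definition component (R : realType) (F : 'cV[R]_2 -> 'cV[R]_2) (i : 'I_2)
    (x : 'cV[R]_2) : R :=
  F x i 0.

Definition divergence (R : realType) (F : 'cV[R]_2 -> 'cV[R]_2)
    (x : 'cV[R]_2) : R :=
  \sum_i partial i (component F i) x.

(* Row [i] is the transposed gradient of [u^i]; the library's ['J] is the
   transpose of this, being set up for row vectors. *)
Definition Jac (R : realType) (u : 'cV[R]_2 -> 'cV[R]_2) (x : 'cV[R]_2)
    : 'M[R]_2 :=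
  \matrix_(i, j) partial j (component u i) x.

Definition legendre_hadamard (R : realType) (A B C D : 'M[R]_2) : Prop :=
  forall xi eta : 'cV[R]_2, xi != 0 -> eta != 0 ->
    0 < eta 0 0 ^+ 2 * dot (A *m xi) xi
        + eta 0 0 * eta 1 0 * dot ((B + C) *m xi) xi
        + eta 1 0 ^+ 2 * dot (D *m xi) xi.

Definition equivalent_systems (R : realType)
    (A B C D A' B' C' D' : 'M[R]_2) : Prop :=
  exists2 M : 'M[R]_2, M \in unitmx &
    block_mx A B C D =
    block_mx (M 0 0)%:M (M 0 1)%:M (M 1 0)%:M (M 1 1)%:M
      *m block_mx A' B' C' D'.

Definition solves_in (R : realType) (A B C D : 'M[R]_2)
    (u : 'cV[R]_2 -> 'cV[R]_2) (S : set 'cV[R]_2) : Prop :=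
  forall x, S x ->
    divergence
      (fun y => A *m grad (component u 0) y + B *m grad (component u 1) y) x = 0 /\
    divergence
      (fun y => C *m grad (component u 0) y + D *m grad (component u 1) y) x = 0.

(* ['D_v] is total (with a junk value where the derivative does not exist);
   polynomial maps being smooth, [solves_in] and [Jac] only ever apply it to
   smooth functions in the theorem. *)
Definition polynomial_map (R : realType) (u : 'cV[R]_2 -> 'cV[R]_2) : Prop :=
  forall i : 'I_2, exists p : {poly {poly R}},
    forall x, component u i x = p.[x 0 0, x 1 0].

Definition homeo_onto (T U : topologicalType) (K : set T) (L : set U)
    (f : T -> U) : Prop :=
  [/\ set_bij K L f, {within K, continuous f} &
      exists g : U -> T,
        {within L, continuous g} /\ (forall x, K x -> g (f x) = x)].

(* Main.v *)
Require Import Defs.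
From HB Require Import structures.
From mathcomp Require Import all_boot all_order all_algebra.
From mathcomp Require Import all_classical all_reals all_analysis.
From mathcomp Require Import ring lra.

Set Implicit Arguments.
Unset Strict Implicit.
Unset Printing Implicit Defensive.

Import Order.TTheory GRing.Theory Num.Theory.
Import numFieldNormedType.Exports.
Local Open Scope classical_set_scope.
Local Open Scope ring_scope.

(** Why the alternative holds.

    Consider maps [u] whose components are a multiple of [x] plus a cubic form.
    Their Jacobian matrix at the origin has rank at most one.  Suppose that, up
    to an invertible linear change of the target, such a map is the fold
    [(x + p, q)], where [q = x ^ 2 y + y ^ 3 / 3] and [p] is any cubic form.
    Since [q] has derivative [x ^ 2 + y ^ 2] in [y], the second component
    increases strictly along the curves where the first one is constant, and
    the fold is injective near the origin although its Jacobian determinant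
    vanishes there ([fold_injective]).  On a small closed disk, which is compact,
    a continuous injective map is a homeomorphism onto its image
    ([compact_injective_homeo]).  So it is enough to find a cubic solution of the
    system with [q] as a prescribed combination of its components; linear terms
    are annihilated by second order operators and come for free.

    A constant coefficient operator [div (A grad _)] maps the cubic forms, a space
    of dimension four, to the linear forms.  Two such operators, one of them
    definite, map the cubic forms isomorphically onto pairs of linear forms as
    soon as they are not proportional: the determinant is the resultant of their
    symbols ([coprime_forms_solvable], [prescribed_pairings]).  By ellipticity, [A]
    and [D] are definite.

    - If [C] is not a multiple of [A], take [u2 = q] and solve both equations for
      the cubic part of [u1].
    - If [B] is not a multiple of [D], take [u1 = q] and solve for [u2].
    - Otherwise [C = c A] and [B = b D], and ellipticity gives [b c <> 1]
      ([legendre_hadamard_triangular]), so that the system amounts to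
      [div (A grad u1) = 0] and [div (D grad u2) = 0].  If [D] is a multiple of
      [A], this is the first case of the alternative.  If not, [q] is the sum of
      a cubic form annihilated by the first operator and one annihilated by the
      second; these are the components of the solution, and their sum is [q]. *)

(** * Elementary calculus and topology *)

Lemma continuous_add (R : realType) (T : topologicalType) (f g : T -> R) :
  continuous f -> continuous g -> continuous (fun x => f x + g x).
Proof. by move=> cf cg x; apply: cvgD; [exact: cf | exact: cg]. Qed.

Lemma continuous_mul (R : realType) (T : topologicalType) (f g : T -> R) :
  continuous f -> continuous g -> continuous (fun x => f x * g x).
Proof. by move=> cf cg x; apply: cvgM; [exact: cf | exact: cg]. Qed.

Lemma continuous_expn (R : realType) (T : topologicalType) (f : T -> R) n :
  continuous f -> continuous (fun x => f x ^+ n).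
Proof.
move=> cf; elim: n => [|n IHn].
  by under eq_fun do rewrite expr0; exact: cst_continuous.
by under eq_fun do rewrite exprS; exact: continuous_mul.
Qed.

Ltac continuity_of_polynomial :=
  repeat lazymatch goal with
  | |- continuous (fun x => x) => by move=> ?; exact: cvg_id
  | |- continuous (fun x => _ + _) => apply: continuous_add
  | |- continuous (fun x => _ * _) => apply: continuous_mul
  | |- continuous (fun x => _ ^+ _) => apply: continuous_expn
  | |- continuous (fun x => fun_of_matrix x _ _) => exact: coord_continuous
  | |- _ => exact: cst_continuous
  end.

(** The topology on matrices is generated by products of neighbourhoods of the
    entries, so that continuity may be tested entrywise. *)
Lemma mx_continuous (T U : topologicalType) (m n : nat) (f : T -> 'M[U]_(m, n)) :
  (forall i j, continuous (fun x => f x i j)) -> continuous f.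
Proof.
move=> cf x Z [P Px PZ].
apply: (@filterS _ _ _ [set y | forall i j, P i j (f y i j)]).
  by move=> y Py; apply: PZ.
apply: filter_forall => i; apply: filter_forall => j.
exact: cf (Px i j).
Qed.

(** Caratheodory's form of the derivative: for a polynomial [f] the factor [g]
    is a polynomial in [h], and the limit defining the derivative is a mere
    evaluation. *)
Lemma derive_caratheodory (R : realType) (V : normedModType R) (f : V -> R)
    (g : R -> R) (x v : V) :
  (forall h, f (h *: v + x) = f x + h * g h) -> {for 0, continuous g} ->
  'D_v f x = g 0.
Proof.
move=> fE cg; apply: cvg_lim => //.
move/continuous_withinNx: cg; apply: cvg_trans.
apply: near_eq_cvg; near=> h.
have h0 : h != 0 by near: h; exact: nbhs_dnbhs_neq.
by rewrite /= fE addrC addKr -[_ *: _]/(_ * _) mulKf.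
Unshelve. all: by end_near.
Qed.

Lemma derive_cubic_expansion (R : realType) (V : normedModType R) (f : V -> R)
    (x v : V) (a b c : R) :
  (forall h, f (h *: v + x) = f x + h * (a + h * b + h * h * c)) ->
  'D_v f x = a.
Proof.
move=> fE; rewrite (derive_caratheodory fE).
  by rewrite !mul0r !addr0.
suff : continuous (fun h : R => a + h * b + h * h * c) by apply.
by continuity_of_polynomial.
Qed.

(** The inverse is continuous because preimages under it are images under [f]:
    [f] maps closed subsets of [K], which are compact, to compact sets, which
    are closed. *)
Lemma compact_injective_homeo (T : ptopologicalType) (U : topologicalType)
    (K : set T) (f : T -> U) :
  hausdorff_space U -> compact K -> {within K, continuous f} ->
  {in K &, injective f} -> homeo_onto K (f @` K) f.
Proof.
move=> hU cK cf injf; split => //; first by split=> // x Kx; exists x.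
pose g y := xget point [set x | K x /\ f x = y].
have gK x : K x -> g (f x) = x.
  move=> Kx; have [Kg fg] : [set x' | K x' /\ f x' = f x] (g (f x)).
    exact: xgetPex (ex_intro _ x (conj Kx erefl)).
  by apply: injf => //; apply/mem_set.
exists g; split => //.
apply/continuous_closedP => Z closedZ; apply/closed_subspaceP.
exists (f @` (K `&` Z)).
  apply: compact_closed => //; apply: continuous_compact.
    exact: continuous_subspaceW cf.
  exact: compact_closedI.
apply/seteqP; split=> y /=.
  by move=> [[x [Kx Zx] <-] fKx]; split => //; rewrite /from_subspace gK.
rewrite /from_subspace => -[Zgy [x Kx xy]]; split; exists x => //.
by split=> //; rewrite -(gK x) // xy.
Qed.

(** * Vectors and matrices of size two *)

Lemma sum_ord2 (R : realType) (F : 'I_2 -> R) : \sum_i F i = F 0 + F 1.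
Proof.
by rewrite !big_ord_recl big_ord0 addr0; congr (_ + F _); apply/val_inj.
Qed.

Lemma ord2P (P : 'I_2 -> Prop) : P 0 -> P 1 -> forall i, P i.
Proof.
by move=> P0 P1 i; case: (unliftP 0 i) => [k|] -> //; rewrite (ord1 k);
  have -> : lift 0 0 = 1 :> 'I_2 by apply/val_inj.
Qed.

Definition vec2 (R : realType) (a b : R) : 'cV[R]_2 :=
  \col_i (if i == 0 then a else b).

Lemma vec2E (R : realType) (a b : R) :
  (vec2 a b 0 0 = a) * (vec2 a b 1 0 = b).
Proof. by rewrite !mxE. Qed.

Lemma vec2_neq0 (R : realType) (a b : R) : (a != 0) || (b != 0) -> vec2 a b != 0.
Proof.
apply: contraL => /eqP ab0.
have := congr1 (fun z : 'cV[R]_2 => z 0 0) ab0; rewrite vec2E mxE => ->.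
have := congr1 (fun z : 'cV[R]_2 => z 1 0) ab0; rewrite vec2E mxE => ->.
by rewrite eqxx.
Qed.

Lemma sym_mx01 (R : realType) (A : 'M[R]_2) : A^T = A -> A 1 0 = A 0 1.
Proof. by move=> {1}<-; rewrite mxE. Qed.

Lemma det_mx22 (R : comPzRingType) (M : 'M[R]_2) :
  \det M = M 0 0 * M 1 1 - M 0 1 * M 1 0.
Proof.
rewrite (expand_det_row _ 0) !big_ord_recl big_ord0 /cofactor !det_mx11 !mxE /=.
have -> : lift 0 0 = 1 :> 'I_2 by apply/val_inj.
have -> : lift 1 0 = 0 :> 'I_2 by apply/val_inj.
by rewrite expr0 expr1 mul1r mulN1r addr0 mulrN.
Qed.

Lemma dot_mul_vec2 (R : realType) (A : 'M[R]_2) (a b : R) :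
  dot (A *m vec2 a b) (vec2 a b) =
  A 0 0 * a ^+ 2 + (A 0 1 + A 1 0) * a * b + A 1 1 * b ^+ 2.
Proof. by rewrite /dot !mxE !sum_ord2 !mxE !sum_ord2 !mxE /=; ring. Qed.

(** * Disks *)

Lemma closure_disk_sqr (R : realType) (r : R) (z : 'cV[R]_2) :
  0 < r -> closure (disk 0 r) z -> z 0 0 ^+ 2 + z 1 0 ^+ 2 <= r ^+ 2.
Proof.
move=> r0; pose f (z : 'cV[R]_2) : R := z 0 0 ^+ 2 + z 1 0 ^+ 2.
have cf : continuous f.
  by rewrite /f; continuity_of_polynomial.
have closedB : closed [set z | f z <= r ^+ 2].
  by have /continuous_closedP cf' := cf; exact: (cf' _ (@closed_le R (r ^+ 2))).
have sub : disk 0 r `<=` [set z | f z <= r ^+ 2].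
  move=> w; rewrite /disk /enorm /dot /= subr0 => wr.
  have fw : (w^T *m w) 0 0 = f w.
    by rewrite !mxE sum_ord2 !mxE /f !expr2.
  rewrite fw in wr.
  have f0 : 0 <= f w by rewrite addr_ge0 // sqr_ge0.
  by rewrite -(sqr_sqrtr f0) ler_sqr ?nnegrE ?sqrtr_ge0 ?ltW.
by move=> /(closureS sub); rewrite -(closure_id _).1.
Qed.

Lemma compact_closure_disk (R : realType) (r : R) :
  0 < r -> compact (closure (disk (0 : 'cV[R]_2) r)).
Proof.
move=> r0.
pose f (ab : R * R) : 'cV[R]_2 := vec2 ab.1 ab.2.
have cf : continuous f.
  apply: mx_continuous => i j; under eq_fun do rewrite mxE.
  by case: (i == 0) => -[a b]; [exact: cvg_fst | exact: cvg_snd].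
apply: (@subclosed_compact _ _ (f @` (`[- r, r] `*` `[- r, r]))).
- exact: closed_closure.
- apply: continuous_compact; first exact: continuous_subspaceT.
  by apply: compact_setX; exact: segment_compact.
- move=> z /(closure_disk_sqr r0) zr.
  exists (z 0 0, z 1 0).
    by split; rewrite /= in_itv /=; apply/andP; split; nra.
  by apply/matrixP; apply: ord2P => j; rewrite (ord1 j) /f vec2E.
Qed.

(** * Cubic maps *)

(** A linear term in the first variable plus a cubic form.  The form is recorded
    by its third derivatives, [s j] being the one taken [3 - j] times in the
    first variable and [j] times in the second.  Differentiating in the first
    variable then keeps the sequence, and differentiating in the second one
    drops its first term. *)
Definition cubic (R : realType) (k : R) (s : nat -> R) (z : 'cV[R]_2) : R :=
  k * z 0 0 + (s 0%N * z 0 0 ^+ 3 + 3 * s 1%N * z 0 0 ^+ 2 * z 1 0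
             + 3 * s 2%N * z 0 0 * z 1 0 ^+ 2 + s 3%N * z 1 0 ^+ 3) / 6.

(** The first derivatives of [cubic], with the same convention on [s]. *)
Definition quadratic (R : realType) (k : R) (s : nat -> R) (z : 'cV[R]_2) : R :=
  k + (s 0%N * z 0 0 ^+ 2 + 2 * s 1%N * z 0 0 * z 1 0 + s 2%N * z 1 0 ^+ 2) / 2.

Definition tail (R : realType) (s : nat -> R) (n : nat) : R := s n.+1.

(** The operator [div (A grad _)] sends the cubic form of coefficients [s] to the
    linear form of coefficients [pairing A s] and [pairing A (tail s)], as
    [divergence_cubic] shows. *)
Definition pairing (R : realType) (A : 'M[R]_2) (s : nat -> R) : R :=
  A 0 0 * s 0%N + (A 0 1 + A 1 0) * s 1%N + A 1 1 * s 2%N.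

Lemma shift0E (R : realType) (h : R) (z : 'cV[R]_2) :
  ((h *: delta_mx 0 0 + z) 0 0 = h + z 0 0) *
  ((h *: delta_mx 0 0 + z) 1 0 = z 1 0).
Proof. by split; rewrite !mxE /= ?mulr1 ?mulr0 ?add0r. Qed.

Lemma shift1E (R : realType) (h : R) (z : 'cV[R]_2) :
  ((h *: delta_mx 1 0 + z) 0 0 = z 0 0) *
  ((h *: delta_mx 1 0 + z) 1 0 = h + z 1 0).
Proof. by split; rewrite !mxE /= ?mulr1 ?mulr0 ?add0r. Qed.

Lemma partial0_cubic (R : realType) (k : R) s :
  partial 0 (cubic k s) = quadratic k s.
Proof.
apply/funext => z; rewrite /partial.
apply: (@derive_cubic_expansion _ _ _ _ _ _
  ((s 0%N * z 0 0 + s 1%N * z 1 0) / 2) (s 0%N / 6)) => h.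
by rewrite /cubic /quadratic !shift0E; field.
Qed.

Lemma partial1_cubic (R : realType) (k : R) s :
  partial 1 (cubic k s) = quadratic 0 (tail s).
Proof.
apply/funext => z; rewrite /partial.
apply: (@derive_cubic_expansion _ _ _ _ _ _
  ((s 2%N * z 0 0 + s 3%N * z 1 0) / 2) (s 3%N / 6)) => h.
by rewrite /cubic /quadratic /tail !shift1E; field.
Qed.

Lemma partial0_quadratic (R : realType) (k : R) s z :
  partial 0 (quadratic k s) z = s 0%N * z 0 0 + s 1%N * z 1 0.
Proof.
apply: (@derive_cubic_expansion _ _ _ _ _ _ (s 0%N / 2) 0) => h.
by rewrite /quadratic !shift0E; field.
Qed.

Lemma partial1_quadratic (R : realType) (k : R) s z :
  partial 1 (quadratic k s) z = s 1%N * z 0 0 + s 2%N * z 1 0.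
Proof.
apply: (@derive_cubic_expansion _ _ _ _ _ _ (s 2%N / 2) 0) => h.
by rewrite /quadratic !shift1E; field.
Qed.

Lemma quadratic_lincomb (R : realType) (a b c d k l m n : R) s t u v z :
  a * quadratic k s z + b * quadratic l t z
    + (c * quadratic m u z + d * quadratic n v z) =
  quadratic (a * k + b * l + c * m + d * n)
    (fun j => a * s j + b * t j + c * u j + d * v j) z.
Proof. by rewrite /quadratic; field. Qed.

Lemma divergence_cubic (R : realType) (A B : 'M[R]_2) (k l : R) s t z :
  divergence (fun y => A *m grad (cubic k s) y + B *m grad (cubic l t) y) z =
  (pairing A s + pairing B t) * z 0 0
  + (pairing A (tail s) + pairing B (tail t)) * z 1 0.
Proof.
rewrite /divergence sum_ord2.
have compE i : component (fun y => A *m grad (cubic k s) y + B *m grad (cubic l t) y) i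
   = quadratic (A i 0 * k + B i 0 * l)
       (fun j => A i 0 * s j + A i 1 * tail s j + B i 0 * t j + B i 1 * tail t j).
  apply/funext => y; rewrite /component /grad !mxE !sum_ord2 !mxE.
  rewrite !partial0_cubic !partial1_cubic quadratic_lincomb.
  by rewrite /quadratic; congr (_ + _ / _); ring.
rewrite !compE partial0_quadratic partial1_quadratic /pairing /tail; ring.
Qed.

Definition cubic_map (R : realType) (k : R) s (l : R) t (z : 'cV[R]_2) : 'cV[R]_2 :=
  vec2 (cubic k s z) (cubic l t z).

Lemma component_cubic_map (R : realType) (k : R) s l t :
  (component (cubic_map k s l t) 0 = cubic k s) *
  (component (cubic_map k s l t) 1 = cubic l t).
Proof. by split; apply/funext => z; rewrite /component vec2E. Qed.

Lemma polynomial_cubic (R : realType) (k : R) s :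
  exists p : {poly {poly R}}, forall z : 'cV[R]_2,
    cubic k s z = p.[z 0 0, z 1 0].
Proof.
pose c (a : R) : {poly {poly R}} := a%:P%:P.
pose Y : {poly {poly R}} := 'X%:P.
exists (c k * 'X + (c (s 0%N) * 'X ^+ 3 + c (3 * s 1%N) * 'X ^+ 2 * Y
  + c (3 * s 2%N) * 'X * Y ^+ 2 + c (s 3%N) * Y ^+ 3) * c 6^-1) => z.
by rewrite /c /Y /cubic !hornerE.
Qed.

Lemma polynomial_cubic_map (R : realType) (k : R) s l t :
  polynomial_map (cubic_map k s l t).
Proof.
by apply: ord2P; rewrite component_cubic_map; exact: polynomial_cubic.
Qed.

Lemma continuous_cubic (R : realType) (k : R) s : continuous (cubic k s).
Proof. by rewrite /cubic; continuity_of_polynomial. Qed.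

Lemma continuous_cubic_map (R : realType) (k : R) s l t :
  continuous (cubic_map k s l t).
Proof.
have [cE0 cE1] := component_cubic_map k s l t.
apply: mx_continuous; apply: ord2P => j; rewrite (ord1 j).
  by rewrite -[X in continuous X]/(component _ 0) cE0; exact: continuous_cubic.
by rewrite -[X in continuous X]/(component _ 1) cE1; exact: continuous_cubic.
Qed.

(** At the origin only the linear terms count, and both are multiples of the
    first variable: the second column of the Jacobian matrix vanishes. *)
Lemma det_Jac_cubic_map (R : realType) (k : R) s l t :
  \det (Jac (cubic_map k s l t) 0) = 0.
Proof.
rewrite (expand_det_col _ 1) big1 // => i _; rewrite mxE.
suff -> : partial 1 (component (cubic_map k s l t) i) 0 = 0 by rewrite mul0r.
elim/ord2P: i; rewrite component_cubic_map partial1_cubic /quadratic !mxE; ring.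
Qed.

(** * Injectivity of a cubic fold *)

(** The values [1 + G], [H], [E], [Q] are the divided differences met in
    [fold_injective], and [t] is the sum of the squares of the two norms.  The
    product [H * E] is of order [t ^+ 2] whereas [Q] is of order [t], so the
    determinant inherits the sign of [Q] when [t] is small. *)
Lemma discrete_jacobian_pos (R : realFieldType) (G H E Q K t : R) :
  0 < t -> 0 <= K -> K * t <= 8^-1 -> `|G| <= K * t -> `|H| <= K * t ->
  `|E| <= t -> t / 6 <= Q -> 0 < (1 + G) * Q - H * E.
Proof.
move=> t0 K0 Kt G_le H_le E_le Q_ge.
have HE : H * E <= 8^-1 * t.
  apply: le_trans (ler_norm _) _; rewrite normrM; apply: ler_pM => //.
  exact: le_trans H_le Kt.
have G78 : 7/8 <= 1 + G by move: G_le; rewrite ler_norml => /andP[]; lra.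
have : 7/8 * (t / 6) <= (1 + G) * Q by apply: ler_pM => //; lra.
by lra.
Qed.

(** The map is [(x + p, q)] with [p] an arbitrary cubic form and
    [q = x ^ 2 y + y ^ 3 / 3].  Its Jacobian determinant is [x ^ 2 + y ^ 2] up to
    terms of order four, hence positive off the origin, but a sign of the
    determinant at each point does not give injectivity at once.  Writing the
    increments of both components as combinations of [x - x'] and [y - y']
    gives a two-point version of this determinant, which is positive as well,
    and Cramer's rule concludes. *)
Lemma fold_injective (R : realFieldType) (s0 s1 s2 s3 : R) :
  exists2 r : R, 0 < r & forall x y x' y',
    x ^+ 2 + y ^+ 2 <= r ^+ 2 -> x' ^+ 2 + y' ^+ 2 <= r ^+ 2 ->
    x + (s0 * x ^+ 3 + 3 * s1 * x ^+ 2 * y + 3 * s2 * x * y ^+ 2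
         + s3 * y ^+ 3) / 6 =
    x' + (s0 * x' ^+ 3 + 3 * s1 * x' ^+ 2 * y' + 3 * s2 * x' * y' ^+ 2
          + s3 * y' ^+ 3) / 6 ->
    x ^+ 2 * y + y ^+ 3 / 3 = x' ^+ 2 * y' + y' ^+ 3 / 3 ->
    x = x' /\ y = y'.
Proof.
pose K := `|s0| + `|s1| + `|s2| + `|s3|.
have K0 : 0 <= K by rewrite !addr_ge0.
have K1 : 0 < K + 1 by lra.
have r0 : 0 < (4 * (K + 1))^-1 by rewrite invr_gt0; lra.
(* This radius gives [K * r ^ 2 <= 1 / 16], thus [K * t <= 1 / 8]. *)
exists (4 * (K + 1))^-1 => // x y x' y'; set r := _^-1 in r0 * => zr zr' fst_eq snd_eq.
have Kr : K * r ^+ 2 <= 16^-1.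
  have rK : r * (4 * (K + 1)) = 1 by rewrite mulVf // gt_eqF //; lra.
  have := sqr_ge0 r; nra.
pose t := x ^+ 2 + y ^+ 2 + x' ^+ 2 + y' ^+ 2.
have x2 := sqr_ge0 x; have y2 := sqr_ge0 y.
have x'2 := sqr_ge0 x'; have y'2 := sqr_ge0 y'.
have t0 : 0 <= t by rewrite /t; lra.
have [t_eq0|tn0] := eqVneq t 0.
  have sq0 (w : R) : w ^+ 2 <= 0 -> w = 0.
    by move=> w2; apply/eqP; rewrite -sqrf_eq0 eq_le w2 sqr_ge0.
  move: t_eq0; rewrite /t => t_eq0.
  have -> : x = 0 by apply: sq0; lra.
  have -> : y = 0 by apply: sq0; lra.
  have -> : x' = 0 by apply: sq0; lra.
  by have -> : y' = 0 by apply: sq0; lra.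
have t_gt0 : 0 < t by rewrite lt0r tn0.
have Kt : K * t <= 8^-1.
  have : K * t <= K * (2 * r ^+ 2) by apply: ler_wpM2l => //; rewrite /t; lra.
  lra.
(* The divided differences: increments in [x] are taken at [y], those in [y]
   at [x'], except that [x ^ 2 y] is split symmetrically in [Q] and [E]. *)
pose G := (s0 * (x ^+ 2 + x * x' + x' ^+ 2) + s1 * (3 * y * (x + x'))
           + s2 * (3 * y ^+ 2) + s3 * 0) / 6.
pose H := (s0 * 0 + s1 * (3 * x' ^+ 2) + s2 * (3 * x' * (y + y'))
           + s3 * (y ^+ 2 + y * y' + y' ^+ 2)) / 6.
pose Q := (x ^+ 2 + x' ^+ 2) / 2 + (y ^+ 2 + y * y' + y' ^+ 2) / 3.
pose E := (x + x') * (y + y') / 2.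
have eq1 : (x - x') * (1 + G) + (y - y') * H = 0.
  by move/eqP: fst_eq; rewrite -subr_eq0 => /eqP <-; rewrite /G /H; field.
have eq2 : (x - x') * E + (y - y') * Q = 0.
  by move/eqP: snd_eq; rewrite -subr_eq0 => /eqP <-; rewrite /E /Q; field.
have comb (w0 w1 w2 w3 : R) : `|w0| <= 6 * t -> `|w1| <= 6 * t ->
    `|w2| <= 6 * t -> `|w3| <= 6 * t ->
    `|(s0 * w0 + s1 * w1 + s2 * w2 + s3 * w3) / 6| <= K * t.
  move=> h0 h1 h2 h3; rewrite normrM (@ger0_norm _ 6^-1) ?invr_ge0 //.
  rewrite ler_pdivrMr // /K -mulrA (mulrC t).
  move: (6 * t) h0 h1 h2 h3 => T h0 h1 h2 h3; rewrite !mulrDl.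
  do 3 (apply: le_trans (ler_normD _ _) _; apply: lerD; last by rewrite normrM ler_wpM2l).
  by rewrite normrM ler_wpM2l.
(* [t] bounds twice the products of two coordinates, by these squares. *)
have xx'D := sqr_ge0 (x + x'); have xx'B := sqr_ge0 (x - x').
have yy'D := sqr_ge0 (y + y'); have yy'B := sqr_ge0 (y - y').
have xyD := sqr_ge0 (x + y); have xyB := sqr_ge0 (x - y).
have x'yD := sqr_ge0 (x' + y); have x'yB := sqr_ge0 (x' - y).
have xy'D := sqr_ge0 (x + y'); have xy'B := sqr_ge0 (x - y').
have x'y'D := sqr_ge0 (x' + y'); have x'y'B := sqr_ge0 (x' - y').
have G_le : `|G| <= K * t.
  by apply: comb; rewrite ler_norml /t; apply/andP; split; lra.
have H_le : `|H| <= K * t.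
  by apply: comb; rewrite ler_norml /t; apply/andP; split; lra.
have E_le : `|E| <= t.
  by rewrite ler_norml /t /E; apply/andP; split; lra.
have Q_ge : t / 6 <= Q by rewrite /t /Q; lra.
have J0 := discrete_jacobian_pos t_gt0 K0 Kt G_le H_le E_le Q_ge.
have : (y - y') * ((1 + G) * Q - H * E) = 0.
  have -> : (y - y') * ((1 + G) * Q - H * E) =
    (1 + G) * ((x - x') * E + (y - y') * Q)
    - E * ((x - x') * (1 + G) + (y - y') * H) by ring.
  by rewrite eq1 eq2 !mulr0 subr0.
move/eqP; rewrite mulf_eq0 (gt_eqF J0) orbF => yy'.
move: eq1; rewrite (eqP yy') mul0r addr0 => /eqP; rewrite mulf_eq0 => /orP[xx'|].
  by split; apply/eqP; rewrite -subr_eq0.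
have := G_le; rewrite ler_norml => /andP[lG _].
by rewrite gt_eqF //; lra.
Qed.

(** The cubic form [x ^ 2 y + y ^ 3 / 3], whose derivative in [y] is the positive
    definite form [x ^ 2 + y ^ 2]. *)
Definition fold_cubic (R : realType) (n : nat) : R := if odd n then 2 else 0.

(** The linear system on the coefficients says that the cubic map solves the
    equations.  The last hypothesis says that the map determines the fold
    [(x + p, q)], as it does when it is the fold up to a linear change of the
    target; injectivity near the origin is then inherited from the fold. *)
Lemma cubic_map_degenerate (R : realType) (A B C D : 'M[R]_2)
    (k : R) s (l : R) t p :
  pairing A s + pairing B t = 0 -> pairing A (tail s) + pairing B (tail t) = 0 ->
  pairing C s + pairing D t = 0 -> pairing C (tail s) + pairing D (tail t) = 0 ->
  (forall z z', cubic k s z = cubic k s z' -> cubic l t z = cubic l t z' ->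
     cubic 1 p z = cubic 1 p z' /\
     cubic 0 (fold_cubic R) z = cubic 0 (fold_cubic R) z') ->
  exists (O : 'cV[R]_2) (r : R) (u : 'cV[R]_2 -> 'cV[R]_2),
    [/\ 0 < r,
        polynomial_map u,
        solves_in A B C D u (disk O r),
        homeo_onto (closure (disk O r)) (u @` closure (disk O r)) u &
        \det (Jac u O) = 0].
Proof.
move=> e1 e2 e3 e4 sep.
have [r r0 injr] := fold_injective (p 0%N) (p 1%N) (p 2%N) (p 3%N).
exists 0, r, (cubic_map k s l t); split=> //.
- exact: polynomial_cubic_map.
- move=> z _; have [-> ->] := component_cubic_map k s l t.
  split; rewrite divergence_cubic.
    by rewrite e1 e2 !mul0r addr0.
  by rewrite e3 e4 !mul0r addr0.
- apply: compact_injective_homeo.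
  + exact: norm_hausdorff.
  + exact: compact_closure_disk.
  + by apply: continuous_subspaceT; exact: continuous_cubic_map.
  move=> z z' /set_mem/(closure_disk_sqr r0) zr /set_mem/(closure_disk_sqr r0) z'r uzz'.
  have u0 := congr1 (fun w : 'cV[R]_2 => w 0 0) uzz'.
  have u1 := congr1 (fun w : 'cV[R]_2 => w 1 0) uzz'.
  rewrite /cubic_map !vec2E in u0 u1.
  have [pzz' qzz'] := sep _ _ u0 u1.
  have [||z0 z1] := injr _ _ _ _ zr z'r.
  + by move: pzz'; rewrite /cubic !mul1r.
  + have qE (w : 'cV[R]_2) : cubic 0 (fold_cubic R) w = w 0 0 ^+ 2 * w 1 0 + w 1 0 ^+ 3 / 3.
      by rewrite /cubic /fold_cubic /=; field.
    by rewrite -!qE.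
  by apply/matrixP; apply: ord2P => j; rewrite (ord1 j).
- exact: det_Jac_cubic_map.
Qed.

(** * Cubic forms with prescribed images under two operators *)

(** The matrix of this linear system is the Sylvester matrix of the two quadratic
    forms.  Its determinant is their resultant, which is nonzero because a
    definite form has no real linear factor, so that it is coprime to every
    form that is not a multiple of it. *)
Lemma coprime_forms_solvable (R : realFieldType) (a0 a1 a2 c0 c1 c2 : R) :
  0 < a0 -> 0 < a0 * a2 - a1 ^+ 2 ->
  ~ (exists m, [/\ c0 = m * a0, c1 = m * a1 & c2 = m * a2]) ->
  forall r0 r1 e0 e1, exists s : nat -> R,
    [/\ a0 * s 0%N + a1 * 2 * s 1%N + a2 * s 2%N = r0,
        a0 * s 1%N + a1 * 2 * s 2%N + a2 * s 3%N = r1,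
        c0 * s 0%N + c1 * 2 * s 1%N + c2 * s 2%N = e0 &
        c0 * s 1%N + c1 * 2 * s 2%N + c2 * s 3%N = e1].
Proof.
move=> a0_gt0 disc nprop r0 r1 e0 e1.
pose m := c0 / a0.
have a0n : a0 != 0 by rewrite gt_eqF.
(* Subtracting [m] times the first form from the second one kills its first
   coefficient; [res] is then the resultant up to the factor [a0]. *)
pose b1 := c1 - m * a1; pose b2 := c2 - m * a2.
have b_neq0 : (b1 != 0) || (b2 != 0).
  rewrite -negb_and; apply/negP => /andP[/eqP b10 /eqP b20]; apply: nprop.
  by exists m; split; [rewrite /m divfK | apply/eqP; rewrite -subr_eq0 -/b1 b10
    | apply/eqP; rewrite -subr_eq0 -/b2 b20].
pose res := a0 * b2 ^+ 2 - 4 * a1 * b1 * b2 + 4 * a2 * b1 ^+ 2.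
have res_gt0 : 0 < res.
  rewrite -(pmulr_rgt0 _ a0_gt0).
  have -> : a0 * res = (a0 * b2 - 2 * a1 * b1) ^+ 2
              + 4 * (a0 * a2 - a1 ^+ 2) * b1 ^+ 2 by rewrite /res; ring.
  have [b10|b1n] := eqVneq b1 0.
    have b2n : b2 != 0 by move: b_neq0; rewrite b10 eqxx.
    by rewrite b10 mulr0 subr0 expr0n mulr0 addr0 exprn_even_gt0 // mulf_neq0.
  have : 0 < b1 ^+ 2 by rewrite exprn_even_gt0.
  have := sqr_ge0 (a0 * b2 - 2 * a1 * b1); nra.
have resn : res != 0 by rewrite gt_eqF.
have c0E : c0 = m * a0 by rewrite /m divfK.
have c1E : c1 = b1 + m * a1 by rewrite /b1 subrK.
have c2E : c2 = b2 + m * a2 by rewrite /b2 subrK.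
pose f0 := e0 - m * r0; pose f1 := e1 - m * r1.
(* The first two equations give [s0] and [s1]; Cramer's rule solves the other
   two, of determinant [res], for [s2] and [s3]. *)
pose g0 := a0 * f0 - 2 * b1 * r1.
pose s2 := (g0 * b2 + 2 * b1 * a2 * f1) / res.
pose s3 := ((a0 * b2 - 4 * a1 * b1) * f1 - 2 * b1 * g0) / res.
pose s1 := (r1 - 2 * a1 * s2 - a2 * s3) / a0.
pose s0 := (r0 - 2 * a1 * s1 - a2 * s2) / a0.
have eq3 : 2 * b1 * s1 + b2 * s2 = f0.
  by rewrite /s1 /s2 /s3 /g0; move: resn; rewrite /res => resn'; field; rewrite a0n resn'.
have eq4 : 2 * b1 * s2 + b2 * s3 = f1.
  by rewrite /s2 /s3 /g0; move: resn; rewrite /res => resn'; field.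
have eq1 : a0 * s0 + a1 * 2 * s1 + a2 * s2 = r0 by rewrite /s0; field.
have eq2 : a0 * s1 + a1 * 2 * s2 + a2 * s3 = r1 by rewrite /s1; field.
exists (fun n => nth 0 [:: s0; s1; s2; s3] n); split => //=.
- have -> : e0 = m * r0 + f0 by rewrite /f0; ring.
  by rewrite -eq1 -eq3 c0E c1E c2E; ring.
- have -> : e1 = m * r1 + f1 by rewrite /f1; ring.
  by rewrite -eq2 -eq4 c0E c1E c2E; ring.
Qed.

Definition positive_definite (R : realType) (A : 'M[R]_2) : Prop :=
  forall z : 'cV[R]_2, z != 0 -> 0 < dot (A *m z) z.

Lemma positive_definite_minors (R : realType) (A : 'M[R]_2) :
  A^T = A -> positive_definite A ->
  0 < A 0 0 /\ 0 < A 0 0 * A 1 1 - A 0 1 ^+ 2.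
Proof.
move=> /sym_mx01 A10 posA.
have a0 : 0 < A 0 0.
  have := posA (vec2 1 0); rewrite dot_mul_vec2 vec2_neq0 ?oner_eq0 // => /(_ isT).
  by rewrite expr1n expr0n /= !mulr0 !addr0 mulr1.
split=> //; rewrite -(pmulr_rgt0 _ a0).
have := posA (vec2 (- A 0 1) (A 0 0)).
rewrite dot_mul_vec2 vec2_neq0 ?(gt_eqF a0) ?orbT // => /(_ isT).
by rewrite A10; congr (0 < _); ring.
Qed.

(** The source of all the cubic solutions: once a component is chosen, each of
    the two equations prescribes the image of the other one under an operator. *)
Lemma prescribed_pairings (R : realType) (A C : 'M[R]_2) :
  A^T = A -> C^T = C -> positive_definite A -> ~ (exists m, C = m *: A) ->
  forall r0 r1 e0 e1, exists s : nat -> R,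
    [/\ pairing A s = r0, pairing A (tail s) = r1,
        pairing C s = e0 & pairing C (tail s) = e1].
Proof.
move=> symA symC posA nprop r0 r1 e0 e1.
have [a0 disc] := positive_definite_minors symA posA.
have A10 := sym_mx01 symA; have C10 := sym_mx01 symC.
have [|s [s1 s2 s3 s4]] := coprime_forms_solvable (c0 := C 0 0) (c1 := C 0 1)
    (c2 := C 1 1) a0 disc _ r0 r1 e0 e1.
  move=> [m [c0 c1 c2]]; apply: nprop; exists m.
  by apply/matrixP; apply: ord2P; apply: ord2P; rewrite !mxE ?C10 ?A10.
exists s; rewrite /pairing /tail A10 C10.
by split; [rewrite -s1|rewrite -s2|rewrite -s3|rewrite -s4]; ring.
Qed.

(** * The alternative *)

Lemma legendre_hadamard_positive_l (R : realType) (A B C D : 'M[R]_2) :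
  legendre_hadamard A B C D -> positive_definite A.
Proof.
move=> hLH; have e0 : vec2 1 0 != 0 :> 'cV[R]_2 by rewrite vec2_neq0 ?oner_eq0.
move=> z z0; have := hLH _ _ z0 e0; rewrite !vec2E.
by rewrite expr1n expr0n /= !(mul0r, mulr0) mul1r !addr0.
Qed.

Lemma legendre_hadamard_positive_r (R : realType) (A B C D : 'M[R]_2) :
  legendre_hadamard A B C D -> positive_definite D.
Proof.
move=> hLH; have e1 : vec2 0 1 != 0 :> 'cV[R]_2 by rewrite vec2_neq0 ?oner_eq0 ?orbT.
move=> z z0; have := hLH _ _ z0 e1; rewrite !vec2E.
by rewrite expr1n expr0n /= !(mul0r, mulr0) mul1r !add0r.
Qed.

(** If [b * c = 1], the Legendre-Hadamard form at [xi] factors as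
    [(eta1 + c eta2) (eta1 A xi . xi + b eta2 D xi . xi)] and vanishes at
    [eta = (- c, 1)]. *)
Lemma legendre_hadamard_triangular (R : realType) (A B C D : 'M[R]_2) (b c : R) :
  legendre_hadamard A B C D -> B = b *: D -> C = c *: A -> 1 - b * c != 0.
Proof.
move=> hLH BE CE; apply/eqP => bc1.
have e0 : vec2 1 0 != 0 :> 'cV[R]_2 by rewrite vec2_neq0 ?oner_eq0.
have eta0 : vec2 (- c) 1 != 0 by rewrite vec2_neq0 ?oner_eq0 ?orbT.
have := hLH _ _ e0 eta0; rewrite !vec2E !dot_mul_vec2 BE CE !mxE.
set v := (X in 0 < X) => v_gt0.
have vE : v = D 0 0 * (1 - b * c) by rewrite /v; ring.
by rewrite vE bc1 mulr0 ltxx in v_gt0.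
Qed.

Lemma equivalent_to_decoupled (R : realType) (A B C D : 'M[R]_2) (b c d : R) :
  B = b *: A -> C = c *: A -> D = d *: A -> d - b * c != 0 ->
  equivalent_systems A B C D A 0 0 A.
Proof.
move=> -> -> -> det_neq0.
pose M : 'M[R]_2 := \matrix_(i, j)
  (if i == 0 then if j == 0 then 1 else b else if j == 0 then c else d).
have [M00 M01 M10 M11] : [/\ M 0 0 = 1, M 0 1 = b, M 1 0 = c & M 1 1 = d].
  by rewrite !mxE.
exists M; first by rewrite unitmxE det_mx22 M00 M01 M10 M11 mul1r unitfE.
by rewrite M00 M01 M10 M11 mulmx_block !mulmx0 !addr0 !add0r !mul_scalar_mx scale1r.
Qed.

Theorem theorem1p6 (R : realType) (A B C D : 'M[R]_2)
    (hA : A^T = A) (hB : B^T = B) (hC : C^T = C) (hD : D^T = D)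
    (hLH : legendre_hadamard A B C D) :
  equivalent_systems A B C D A 0 0 A \/
  exists (O : 'cV[R]_2) (r : R) (u : 'cV[R]_2 -> 'cV[R]_2),
    [/\ 0 < r,
        polynomial_map u,
        solves_in A B C D u (disk O r),
        homeo_onto (closure (disk O r)) (u @` closure (disk O r)) u &
        \det (Jac u O) = 0].
Proof.
have posA := legendre_hadamard_positive_l hLH.
have posD := legendre_hadamard_positive_r hLH.
pose q := fold_cubic R.
have [[c CE]|nCA] := pselect (exists c, C = c *: A); last first.
  right.
  have [p [p1 p2 p3 p4]] := prescribed_pairings hA hC posA nCA
    (- pairing B q) (- pairing B (tail q)) (- pairing D q) (- pairing D (tail q)).
  apply: (@cubic_map_degenerate _ _ _ _ _ 1 p 0 q p) => //.
  - by rewrite p1 addNr.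
  - by rewrite p2 addNr.
  - by rewrite p3 addNr.
  - by rewrite p4 addNr.
have [[b BE]|nBD] := pselect (exists b, B = b *: D); last first.
  right.
  have [p [p1 p2 p3 p4]] := prescribed_pairings hD hB posD nBD
    (- pairing C q) (- pairing C (tail q)) (- pairing A q) (- pairing A (tail q)).
  apply: (@cubic_map_degenerate _ _ _ _ _ 0 q 1 p p) => //.
  - by rewrite p3 addrN.
  - by rewrite p4 addrN.
  - by rewrite p1 addrN.
  - by rewrite p2 addrN.
have bc_neq1 := legendre_hadamard_triangular hLH BE CE.
have [[d DE]|nDA] := pselect (exists d, D = d *: A).
  left; apply: (@equivalent_to_decoupled _ _ _ _ _ (b * d) c d) => //.
    by rewrite BE DE scalerA.
  have d_neq0 : d != 0.
    apply/eqP => d0.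
    have := posD (vec2 1 0); rewrite vec2_neq0 ?oner_eq0 // => /(_ isT).
    by rewrite DE d0 scale0r mul0mx /dot trmx0 mul0mx mxE ltxx.
  have -> : d - b * d * c = d * (1 - b * c) by ring.
  by rewrite mulf_neq0.
right.
(* Here [p] is annihilated by [A] and [q - p] by [D], which decouples both
   equations; the linear terms of the two components cancel in their sum. *)
have [p [p1 p2 p3 p4]] := prescribed_pairings hA hD posA nDA
    0 0 (pairing D q) (pairing D (tail q)).
have pairingZ a (M : 'M[R]_2) s : pairing (a *: M) s = a * pairing M s.
  by rewrite /pairing !mxE; ring.
have pairingB (M : 'M[R]_2) s t :
    pairing M (fun n => s n - t n) = pairing M s - pairing M t.
  by rewrite /pairing; ring.
have tailB s t : tail (fun n => s n - t n) = (fun n => tail s n - tail t n) :> (nat -> R).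
  by [].
pose t n := q n - p n.
apply: (@cubic_map_degenerate _ _ _ _ _ 1 p (- 1) t p).
- by rewrite BE pairingZ pairingB p1 p3 subrr mulr0 addr0.
- by rewrite BE pairingZ tailB pairingB p2 p4 subrr mulr0 addr0.
- by rewrite CE pairingZ pairingB p1 p3 subrr mulr0 addr0.
- by rewrite CE pairingZ tailB pairingB p2 p4 subrr mulr0 addr0.
move=> z z' pzz' tzz'; split=> //.
have qE w : cubic 0 q w = cubic (- 1) t w + cubic 1 p w.
  by rewrite /cubic /t; field.
by rewrite !qE pzz' tzz'.
Qed.
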